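(* Let $q\in Q\setminus 0_Q$, and let $J:T_qQ\to T_qQ$ be a real linear map with $J^2=-I$ such that the set of real two-dimensional linear subspaces $P$ of $T_qQ$ which are isotropic with respect to $(d\omega)_q$ (that is, $(d\omega)_q(v,w)=0$ for all $v,w\in P$) is equal to the set of one-dimensional complex linear subspaces of $T_qQ$ with respect to the complex structure $J$. Then $J$ is equal to plus or minus multiplication by $i$ for the given complex structure of $T_qQ$. That is, the complex structure on $T_qQ$ with this property is unique up to its sign.
   Context: $S$ is the unit sphere in $\mathbb{R}^3$, $T_sS=s^\perp\subset\mathbb{R}^3$. For $s\in S$, $Q_s$ is the real two-dimensional space of symmetric trace-zero linear maps $T_sS\to T_sS$ (nonzero elements are invertible); these form a vector bundle $\pi:Q\to S$ with zero section $0_Q$. On $Q\setminus 0_Q$, $\omega$ is the $\mathbb{R}^3$-valued one-form $\omega_q(v)=q^{-1}(T_q\pi(v))$. Given complex structure. $S\setminus\{-e_3\}$ has the complex coordinate $u=u_1+iu_2\in\mathbb{C}$ with $s(u)=(1+|u|^2)^{-1}(-2u_1,-2u_2,1-|u|^2)$; near $-e_3$ the coordinate is $v=1/u$ (with $v=0$ at $-e_3$). A nonzero $A\in Q_{s(u)}$ has fiber coordinate $q\in\mathbb{C}\setminus\{0\}$ determined by $A^{-1}(T_us(\delta u))=\operatorname{Re}\left[\frac{-2\,\delta u}{q}\,(1-u^2,\,i(1+u^2),\,2u)\right]$ for all $\delta u\in\mathbb{C}$, and $A=0$ has $q=0$. Together with the coordinates $(v,r)=(u^{-1},u^{-4}q)$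 over $S\setminus\{e_3\}$, this makes $Q$ a two-dimensional complex manifold, a holomorphic line bundle over $S\simeq\mathbb{C}\mathbb{P}^1$. *)

(* Defs.v *)
From HB Require Import structures.
From mathcomp Require Import all_boot all_order all_algebra.
From mathcomp Require Import all_classical all_reals all_analysis.
From mathcomp Require Import complex ring.

Set Implicit Arguments.
Unset Strict Implicit.
Unset Printing Implicit Defensive.

Import Order.TTheory GRing.Theory Num.Theory.
Import numFieldNormedType.Exports.

Local Open Scope classical_set_scope.
Local Open Scope complex_scope.
Local Open Scope ring_scope.

(** * The bundle [Q] *)

Definition dot (R : realType) (x y : 'rV[R]_3) : R := (x *m y^T) 0 0.

Definition e3 (R : realType) : 'rV[R]_3 := delta_mx 0 2.

Definition sphere (R : realType) : set 'rV[R]_3 := [set s | dot s s = 1].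

Notation ambient R := ('rV[R]_3 * 'M[R]_3)%type.

(* Vectors are rows and linear maps act on the right.  A pair [q = (s, A)] is
   the point of the fibre over [s] given by the restriction of [A] to the plane
   [s^\perp]: a symmetric trace-zero endomorphism of that plane is extended by
   [0] on [s].  The extension being symmetric, it maps into [s^\perp], and it
   has the same trace.  The bundle projection is [fst]. *)
Definition Qset (R : realType) : set (ambient R) :=
  [set q | [/\ sphere q.1, q.2^T = q.2, q.1 *m q.2 = 0 & \tr q.2 = 0]].

(* The derivative at [q] of the equations defining [Qset]. *)
Definition Qeqs (R : realType) (q v : ambient R) :
    (R^o * 'M[R]_3 * 'rV[R]_3 * R^o)%type :=
  (dot q.1 v.1, v.2^T - v.2, v.1 *m q.2 + q.1 *m v.2, \tr v.2).

Fact Qeqs_is_linear (R : realType) (q : ambient R) : linear (Qeqs q).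
Proof.
move=> a v w; rewrite /Qeqs /dot /=; congr (_, _, _, _).
- by rewrite linearP mulmxDr -scalemxAr !mxE.
- by rewrite linearD linearZ [RHS]/= scalerBr opprD addrACA.
- by rewrite mulmxDl mulmxDr -scalemxAl -scalemxAr [RHS]/= scalerDr addrACA.
- exact: linearP.
Qed.

HB.instance Definition _ (R : realType) (q : ambient R) :=
  GRing.isLinear.Build R (ambient R) (R^o * 'M[R]_3 * 'rV[R]_3 * R^o)%type _
    (Qeqs q) (Qeqs_is_linear q).

Definition TQ (R : realType) (q : ambient R) : {vspace ambient R} :=
  lker (linfun (Qeqs q)).

Lemma mem_TQ (R : realType) (q v : ambient R) :
  v \in TQ q <-> [/\ dot q.1 v.1 = 0, v.2^T = v.2,
                     v.1 *m q.2 + q.1 *m v.2 = 0 & \tr v.2 = 0].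
Proof.
rewrite /TQ memv_ker lfunE /= /Qeqs; split.
  by move=> /eqP [-> /eqP]; rewrite subr_eq0 => /eqP -> -> ->.
by move=> [-> -> -> ->]; rewrite subrr.
Qed.

Lemma is_derive_mxP (R : realType) m n (M : R -> 'M[R]_(m, n)) (t : R) D :
  is_derive t (1:R) M D <->
  forall i j, is_derive t (1:R) (fun x => M x i j) (D i j).
Proof.
split.
  move=> [dM <-] i j; apply: DeriveDef.
    by apply: (iffLR (derivable_mxP _ _ _)).
  by rewrite derive_mx// mxE.
move=> H; have dM : derivable M t (1:R).
  by apply/derivable_mxP => i j; case: (H i j).
apply: DeriveDef => //; rewrite derive_mx//; apply/matrixP => i j; rewrite mxE.
by case: (H i j).
Qed.

Lemma is_derive_cvgP (R : realType) (V : normedModType R) (f : R -> V) (t:R) D :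
  is_derive t (1:R) f D <->
  (h^-1 *: (f (h *: (1:R) + t) - f t)) @[h --> (0:R)^'] --> D.
Proof.
split=> [[df <-]|H]; first exact: df.
by apply: DeriveDef; [apply/cvg_ex; exists D|exact: cvg_lim H].
Qed.

Lemma is_derive_pairP (R : realType) (V W : normedModType R) (f : R -> V * W)
    (t : R) (D : V * W) :
  is_derive t (1:R) f D <->
  is_derive t (1:R) (fun x => (f x).1) D.1 /\
  is_derive t (1:R) (fun x => (f x).2) D.2.
Proof.
rewrite !is_derive_cvgP; split.
  move=> H; split.
    apply: (@cvg_comp _ _ _ _ fst _ _ _ H).
    exact: (@cvg_fst _ _ (nbhs D.1) (nbhs D.2) (nbhs_filter D.2)).
  apply: (@cvg_comp _ _ _ _ snd _ _ _ H).
    exact: (@cvg_snd _ _ (nbhs D.1) (nbhs D.2) (nbhs_filter D.1)).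
case=> H1 H2; have := cvg_pair H1 H2.
by case: D {H1 H2} => a b H; exact: H.
Qed.

Lemma is_derive_mulmx (R : realType) m n p (M : R -> 'M[R]_(m, n))
    (N : R -> 'M[R]_(n, p)) (t : R) dM dN :
  is_derive t (1:R) M dM -> is_derive t (1:R) N dN ->
  is_derive t (1:R) (fun x => M x *m N x) (dM *m N t + M t *m dN).
Proof.
move=> /is_derive_mxP HM /is_derive_mxP HN; apply/is_derive_mxP => i j.
have -> : (fun x => (M x *m N x) i j) = \sum_k (fun x => M x i k * N x k j).
  by apply/funext => x; rewrite mxE fct_sumE.
rewrite !mxE -big_split /=; apply: is_derive_sum => k.
have := is_deriveM (HM i k) (HN k j).
by rewrite [in X in _ -> X]addrC [X in _ + X]mulrC.
Qed.

Lemma is_derive_trmx (R : realType) m n (M : R -> 'M[R]_(m, n)) (t : R) dM :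
  is_derive t (1:R) M dM -> is_derive t (1:R) (fun x => (M x)^T) dM^T.
Proof.
move=> /is_derive_mxP H; apply/is_derive_mxP => i j; rewrite mxE.
by have := H j i; congr is_derive; apply/funext => x; rewrite mxE.
Qed.

Lemma is_derive_mxtrace (R : realType) n (M : R -> 'M[R]_n) (t : R) dM :
  is_derive t (1:R) M dM -> is_derive t (1:R) (fun x => \tr (M x)) (\tr dM).
Proof.
move=> /is_derive_mxP H; rewrite /mxtrace.
have -> : (fun x => \sum_i M x i i) = \sum_i (fun x => M x i i).
  by apply/funext => x; rewrite fct_sumE.
exact: is_derive_sum.
Qed.

Lemma is_derive_scale (R : realType) m n (f : R -> R) (M : R -> 'M[R]_(m,n))
   (t : R) df dM :
  is_derive t (1:R) f df -> is_derive t (1:R) M dM ->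
  is_derive t (1:R) (fun x => f x *: M x) (df *: M t + f t *: dM).
Proof.
move=> Hf /is_derive_mxP H; apply/is_derive_mxP => i j; rewrite !mxE.
have := is_deriveM Hf (H i j).
rewrite [in X in _ -> X]addrC [X in _ + X]mulrC.
by congr is_derive; apply/funext => x; rewrite mxE.
Qed.

Lemma is_derive_eq_near (R : realType) (V : normedModType R) (f g : R -> V)
    (t : R) D :
  (\forall x \near t, f x = g x) -> is_derive t (1:R) f D ->
  is_derive t (1:R) g D.
Proof.
move=> fg [df <-]; apply: DeriveDef.
  by apply: near_eq_derivable df => //; exact: oner_neq0.
by apply/esym/near_eq_derive => //; exact: oner_neq0.
Qed.

Lemma is_derive_ext (R : realType) (V : normedModType R) (f g : R -> V)
    (t : R) D E :
  (forall x, f x = g x) -> D = E -> is_derive t (1:R) f D ->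
  is_derive t (1:R) g E.
Proof. by move=> /funext -> ->. Qed.

(* [TQ q] is the set of velocities at [q] of the curves in [Q]. *)
Lemma TQ_velocity (R : realType) (q v : ambient R) : Qset q ->
  v \in TQ q <->
  exists gam : R -> ambient R,
    [/\ \forall t \near (0 : R), Qset (gam t), gam 0 = q &
        is_derive (0:R) (1:R) gam v].
Proof.
move=> [sq symq sA trq]; rewrite mem_TQ; split; last first.
  move=> [g [Qg g0 /is_derive_pairP [d1 d2]]].
  have cst (V : normedModType R) (f : R -> V) (c D : V) :
      (\forall t \near (0:R), f t = c) -> is_derive (0:R) (1:R) f D -> D = 0.
    move=> fc Hf; have [_ <-] := is_derive_eq_near fc Hf.
    exact: derive_cst.
  split.
  - have := is_derive_mulmx d1 (is_derive_trmx d1).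
    move=> /is_derive_mxP /(_ 0 0) /cst => /(_ 1).
    have H : \forall t \near (0:R), ((g t).1 *m ((g t).1)^T) 0 0 = 1.
      by near=> t; have [] : Qset (g t) by near: t.
    move=> /(_ H); rewrite g0 -[v.1 *m _]trmxK trmx_mul trmxK mxE mxE /dot.
    by move/eqP; rewrite -mulr2n mulrn_eq0 /= => /eqP.
  - have := is_derive_eq_near _ (is_derive_trmx d2) => /(_ (fun x => (g x).2)).
    case; first by near=> t; have [] : Qset (g t) by near: t.
    by move=> _ <-; case: d2.
  - have := is_derive_mulmx d1 d2; rewrite g0; apply: (cst _ _ 0) => /=.
    by near=> t; have [] : Qset (g t) by near: t.
  - have := is_derive_mxtrace d2; apply: (cst _ _ 0) => /=.
    by near=> t; have [] : Qset (g t) by near: t.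
move=> [sv symv Av trv].
pose s := q.1; pose A := q.2; pose sg := v.1; pose B := v.2.
pose k := dot sg sg / 4.
have k0 : 0 <= k.
  rewrite divr_ge0// /dot mxE sumr_ge0// => i _; rewrite mxE; exact: sqr_ge0.
have n0 t : 1 + k * t ^+ 2 != 0.
  by rewrite gt_eqF// ltr_pwDl// mulr_ge0// sqr_ge0.
pose c t := (1 - k * t ^+ 2) / (1 + k * t ^+ 2).
pose b t := t / (1 + k * t ^+ 2).
pose S t := c t *: s + b t *: sg.
pose P t : 'M[R]_3 := 1%:M - (S t)^T *m S t.
pose C t := A + t *: B.
pose N t := P t *m C t *m P t.
pose T t := N t - (2^-1 * \tr (N t)) *: P t.
have c0 : c 0 = 1 by rewrite /c expr0n /= mulr0 subr0 addr0 divr1.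
have b0 : b 0 = 0 by rewrite /b mul0r.
have S0 : S 0 = s by rewrite /S c0 b0 scale1r scale0r addr0.
have SS t : S t *m (S t)^T = 1%:M.
  have e1 : s *m s^T = 1%:M by rewrite [LHS]mx11_scalar; congr _%:M.
  have e2 : s *m sg^T = 0 by rewrite [LHS]mx11_scalar [X in X%:M]sv raddf0.
  have e3 : sg *m s^T = 0 by rewrite -[LHS]trmxK trmx_mul trmxK e2 trmx0.
  have e4 : sg *m sg^T = (4 * k)%:M.
    by rewrite /k mulrCA divff ?mulr1 ?pnatr_eq0// [LHS]mx11_scalar.
  rewrite /S linearD !linearZ /= mulmxDl !mulmxDr.
  rewrite -!scalemxAl -!scalemxAr !scalerA e1 e2 e3 e4 !scaler0 addr0 add0r.
  rewrite !scale_scalar_mx -raddfD /=; congr _%:M; rewrite /c /b.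
  by move: (n0 t) => nt; field.
have PT t : (P t)^T = P t.
  by rewrite /P linearB /= trmx1 trmx_mul trmxK.
have SP t : S t *m P t = 0.
  by rewrite /P mulmxBr mulmx1 mulmxA SS mul1mx subrr.
have trP t : \tr (P t) = 2.
  rewrite /P linearB /= mxtrace1 mxtrace_mulC SS mxtrace1 -natrB//.
have NT t : (N t)^T = N t.
  have CT : (C t)^T = C t by rewrite /C linearD linearZ /= symq symv.
  by rewrite /N !trmx_mul PT CT mulmxA.
exists (fun t => (S t, T t)); split.
- near=> t; split => /=.
  + by rewrite /sphere /= /dot SS mxE eqxx.
  + by rewrite /T linearB linearZ /= NT PT.
  + by rewrite /T mulmxBr -scalemxAr SP scaler0 subr0 /N !mulmxA SP !mul0mx.
  + by rewrite /T linearB linearZ /= trP mulrAC mulVf ?pnatr_eq0// mul1r subrr.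
- have P0 : P 0 = 1%:M - s^T *m s by rewrite /P S0.
  have sA0 : s *m A = 0 := sA.
  have As0 : A *m s^T = 0 by rewrite -[LHS]trmxK trmx_mul trmxK symq sA0 trmx0.
  have N0 : N 0 = A.
    rewrite /N /C scale0r addr0 P0 mulmxBl mul1mx -mulmxA sA0 mulmx0 subr0.
    by rewrite mulmxBr mulmx1 mulmxA As0 mul0mx subr0.
  rewrite S0 /T N0 [\tr A]trq mulr0 scale0r subr0.
  by rewrite [RHS]surjective_pairing.
apply/is_derive_pairP => /=.
have sA0 : s *m A = 0 := sA.
have As0 : A *m s^T = 0 by rewrite -[LHS]trmxK trmx_mul trmxK symq sA0 trmx0.
have P0 : P 0 = 1%:M - s^T *m s by rewrite /P S0.
have AP : A *m P 0 = A by rewrite P0 mulmxBr mulmx1 mulmxA As0 mul0mx subr0.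
have PA : P 0 *m A = A by rewrite P0 mulmxBl mul1mx -mulmxA sA0 mulmx0 subr0.
have did : is_derive (0:R) (1:R) (fun t : R => t) 1 by exact: is_derive_id.
have dsq : is_derive (0:R) (1:R) (fun t : R => k * t ^+ 2) 0.
  have := is_deriveM (is_derive_cst k (0:R) (1:R)) (is_deriveM did did).
  apply: is_derive_ext.
  - by move=> t; rewrite expr2.
  - by rewrite !scale0r addr0 scaler0 scaler0 addr0.
have dD : is_derive (0:R) (1:R) (fun t : R => 1 + k * t ^+ 2) 0.
  have := is_deriveD (is_derive_cst (1:R) (0:R) (1:R)) dsq.
  by apply: is_derive_ext => //; rewrite addr0.
have dinv : is_derive (0:R) (1:R) (fun t : R => (1 + k * t ^+ 2)^-1) 0.
  have := @is_deriveV R (fun t : R => 1 + k * t ^+ 2) 0 0 1 (n0 0) dD.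
  by apply: is_derive_ext => //; rewrite scaler0.
have dc : is_derive (0:R) (1:R) c 0.
  have := is_deriveM (is_deriveB (is_derive_cst (1:R) (0:R) (1:R)) dsq) dinv.
  by apply: is_derive_ext => //; rewrite subrr !scaler0 addr0.
have db : is_derive (0:R) (1:R) b 1.
  have := is_deriveM did dinv.
  apply: is_derive_ext => //.
  by rewrite scaler0 add0r expr0n mulr0 addr0 invr1 scale1r.
have dS : is_derive (0:R) (1:R) S sg.
  have h1 := is_derive_scale dc (is_derive_cst s (0:R) (1:R)).
  have h2 := is_derive_scale db (is_derive_cst sg (0:R) (1:R)).
  have := is_deriveD h1 h2.
  by rewrite !scale0r !scaler0 scale1r !addr0 add0r.
split=> //.
pose D := - (sg^T *m s + s^T *m sg).
have dP : is_derive (0:R) (1:R) P D.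
  have := is_deriveB (is_derive_cst 1%:M (0:R) (1:R))
    (is_derive_mulmx (is_derive_trmx dS) dS).
  by rewrite sub0r S0.
have dC : is_derive (0:R) (1:R) C B.
  have := is_deriveD (is_derive_cst A (0:R) (1:R))
    (is_derive_scale did (is_derive_cst B (0:R) (1:R))).
  by rewrite scale1r scale0r addr0 add0r.
have C0 : C 0 = A by rewrite /C scale0r addr0.
have dN : is_derive (0:R) (1:R) N B.
  have := is_derive_mulmx (is_derive_mulmx dP dC) dP.
  rewrite C0 PA mulmxDl.
  suff -> : D *m A *m P 0 + P 0 *m B *m P 0 + A *m D = B by [].
  rewrite -mulmxA AP.
  have sB : s *m B = - (sg *m A).
    by apply/eqP; rewrite -addr_eq0 addrC; apply/eqP.
  have Bs : B *m s^T = - (A *m sg^T).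
    by rewrite -[LHS]trmxK trmx_mul trmxK symv sB linearN /= trmx_mul symq.
  rewrite P0 mulmxBl mulmxBr mul1mx !mulmxBl mulmx1.
  rewrite /D mulNmx mulmxN mulmxDl mulmxDr -!mulmxA.
  have BsS : B *m (s^T *m s) = - (A *m (sg^T *m s)).
    by rewrite mulmxA Bs mulNmx -mulmxA.
  have sBsS : s *m (B *m (s^T *m s)) = 0.
    by rewrite mulmxA sB mulNmx -mulmxA [A *m _]mulmxA As0 mul0mx mulmx0 oppr0.
  rewrite sBsS BsS mulmx1 sB sA0 [A *m (s^T *m _)]mulmxA As0 mul0mx !mulmx0.
  rewrite add0r addr0 subr0 mulmxN !opprK.
  by rewrite -!addrA subrr addr0 addrC addrK.
have N0 : N 0 = A by rewrite /N C0 PA AP.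
have := is_deriveB dN (is_derive_scale (is_deriveM
  (is_derive_cst (2^-1 : R) (0:R) (1:R)) (is_derive_mxtrace dN)) dP).
apply: is_derive_ext => //=.
rewrite [X in _ - X](_ : _ = 0) ?subr0//.
have -> : (cst (2^-1 : R) * (fun x => \tr (N x))) 0 = 2^-1 * \tr (N 0) by [].
by rewrite N0 [\tr A]trq [\tr B]trv mulr0 !scaler0 addr0 !scale0r addr0.
Unshelve. all: by end_near. Qed.

(** * The one-form [omega] *)

(* [(A|_{s^\perp})^{-1} w] for [q = (s, A)] with [A <> 0] and [w \perp s]. *)
Definition fibre_inv (R : realType) (q : ambient R) (w : 'rV[R]_3) : 'rV[R]_3 :=
  xget 0 [set x | dot q.1 x = 0 /\ x *m q.2 = w].

Definition omega (R : realType) (q v : ambient R) : 'rV[R]_3 :=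
  fibre_inv q v.1.

(** * The complex structure of [Q] *)

(* [R * R] is the complex plane as a real normed space. *)
Notation plane R := (R * R)%type.

Definition toC (R : realType) (x : plane R) : R[i] := x.1 +i* x.2.

Definition ofC (R : realType) (z : R[i]) : plane R :=
  (complex.Re z, complex.Im z).

Definition imul (R : realType) (x : plane R * plane R) : plane R * plane R :=
  (ofC ('i%C * toC x.1), ofC ('i%C * toC x.2)).

Definition stereo (R : realType) (u : plane R) : 'rV[R]_3 :=
  let n := u.1 ^+ 2 + u.2 ^+ 2 in
  (1 + n)^-1 *: \row_(j < 3) [:: - 2 * u.1; - 2 * u.2; 1 - n]`_j.

Definition null_vec (R : realType) (u : R[i]) (j : 'I_3) : R[i] :=
  [:: 1 - u ^+ 2; 'i%C * (1 + u ^+ 2); 2 * u]`_j.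

(* [(u, q)] are the coordinates of [p], with [p] over [S \ {- e3}]. *)
Definition has_coord (R : realType) (x : plane R * plane R) (p : ambient R) :
    Prop :=
  let: (u, q) := x in
  [/\ Qset p, p.1 = stereo u &
      if toC q == 0 then p.2 = 0
      else p.2 != 0 /\
           forall du : plane R,
             fibre_inv p ('D_du (@stereo R) u) =
             \row_(j < 3) complex.Re
                (- 2 * toC du / toC q * null_vec (toC u) j)].

(* The inverse of the chart with coordinates [(u, q)]. *)
Definition param_u (R : realType) (x : plane R * plane R) : ambient R :=
  xget 0 [set p | has_coord x p].

(* The inverse of the chart with coordinates [(v, r) = (u^-1, u^-4 q)], extended
   by continuity to [v = 0], that is, to the fibre over [- e3]. *)
Definition param_v (R : realType) (y : plane R * plane R) : ambient R :=
  let f (v : plane R) : ambient R :=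
    param_u (ofC (toC v)^-1, ofC (toC y.2 / toC v ^+ 4)) in
  if y.1 == 0 then
    xget 0 [set p : ambient R | f v @[v --> (0 : plane R)^'] --> p]
  else f y.1.

Definition param (R : realType) (q : ambient R) :
    plane R * plane R -> ambient R :=
  if q.1 == - e3 R then @param_v R else @param_u R.

Definition chart_coord (R : realType) (q : ambient R) : plane R * plane R :=
  xget 0 [set x | param q x = q].

(* The coordinates of a vector [v] tangent to [Q] at [q]. *)
Definition tcoord (R : realType) (q v : ambient R) : plane R * plane R :=
  xget 0 [set xi | 'D_xi (param q) (chart_coord q) = v].

Definition mulI (R : realType) (q v : ambient R) : ambient R :=
  'D_(imul (tcoord q v)) (param q) (chart_coord q).

(** * The exterior derivative of [omega] *)

(* It is computed in the chart at [q], with the convention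
   [d alpha (xi, eta) = xi (alpha eta) - eta (alpha xi)] for constant vector
   fields [xi] and [eta]. *)
Definition pullback_omega (R : realType) (phi : plane R * plane R -> ambient R)
    (x xi : plane R * plane R) : 'rV[R]_3 :=
  omega (phi x) ('D_xi phi x).

Definition ext_deriv (R : realType)
    (alpha : plane R * plane R -> plane R * plane R -> 'rV[R]_3)
    (x xi eta : plane R * plane R) : 'rV[R]_3 :=
  'D_xi (alpha^~ eta) x - 'D_eta (alpha^~ xi) x.

Definition domega (R : realType) (q v w : ambient R) : 'rV[R]_3 :=
  ext_deriv (pullback_omega (param q)) (chart_coord q)
    (tcoord q v) (tcoord q w).

(** * Subspaces of the tangent space *)

Definition isotropic (R : realType) (q : ambient R)
    (P : {vspace subvs_of (TQ q)}) : Prop :=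
  forall v w, v \in P -> w \in P -> domega q (vsval v) (vsval w) = 0.

(* The complex span, for the complex structure [J], of a nonzero vector. *)
Definition complex_line (R : realType) (V : vectType R) (J : 'End(V))
    (P : {vspace V}) : Prop :=
  exists2 v : V, v != 0 & P = (<[v]> + <[J v]>)%VS.

(* Main.v *)
Require Import Defs.
From HB Require Import structures.
From mathcomp Require Import all_boot all_order all_algebra.
From mathcomp Require Import all_classical all_reals all_analysis.
From mathcomp Require Import complex ring.

Set Implicit Arguments.
Unset Strict Implicit.
Unset Printing Implicit Defensive.

Import Order.TTheory GRing.Theory Num.Theory.
Import numFieldNormedType.Exports.

Local Open Scope classical_set_scope.
Local Open Scope complex_scope.
Local Open Scope ring_scope.

(** The coordinates $(u, q)$ of the bundle have an explicit inverse.  Write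
    $\nu(u) = (1 - u^2, i(1 + u^2), 2u) = a + ib$ with $a, b$ real.  Then $a$ and
    $b$ are orthogonal to $s(u)$ and to each other, both have length
    $1 + |u|^2$, and the differential of $s$ is
    $ds(\delta) = -2 (1 + |u|^2)^{-2} (\delta_1 a + \delta_2 b)$.  So the point with
    coordinates $(u, q)$ is the symmetric matrix
    $(1 + |u|^2)^{-4} Re(\bar q \nu^T \nu)$ ([fib]).  The chart around $-e_3$ is
    the same map followed by the half turn about the first axis, because
    $\nu(1/v) = - v^{-2} \nu(v)$ up to that half turn.  All computations are
    therefore made for one map, [rotated_param g] with [g] orthogonal;
    [param_uE] and [param_vE] identify it with the two charts.

    In these coordinates $\omega = Re(-2 q^{-1} \nu(u) du)$.  As $\nu$ depends on
    $u$ only, its derivative drops out of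
    $d\omega(\xi, \eta) = Re(2 q^{-2} (\xi_2 \eta_1 - \eta_2 \xi_1) \nu(u))$,
    and since $a$ and $b$ are linearly independent, this vanishes only if the
    complex determinant of $\xi, \eta$ does
    ([ext_deriv_pullback_eq0]).  Now the plane spanned by $v$ and $J v$ is a
    complex line for $J$, hence isotropic, hence $v$ and $J v$ are linearly
    dependent over the given complex structure.  An additive map of a
    two-dimensional complex vector space that sends every vector to a complex
    multiple of itself is multiplication by one complex number $l$ ([complex_direction_scalar]), and
    $J^2 = -1$ gives $l^2 = -1$, so $l = \pm i$. *)

(** * The frame of the tangent plane given by the null vector *)

Section Frame.
Variable R : realType.
Implicit Types (u c d w : plane R) (x y z : 'rV[R]_3).

Definition normsq u : R := 1 + (u.1 ^+ 2 + u.2 ^+ 2).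

Lemma normsq_neq0 u : normsq u != 0.
Proof. by rewrite gt_eqF// ltr_pwDl// addr_ge0// sqr_ge0. Qed.

Definition nu_re u : 'rV[R]_3 :=
  \row_j [:: 1 - u.1 ^+ 2 + u.2 ^+ 2; - 2 * u.1 * u.2; 2 * u.1]`_j.

Definition nu_im u : 'rV[R]_3 :=
  \row_j [:: - 2 * u.1 * u.2; 1 + u.1 ^+ 2 - u.2 ^+ 2; 2 * u.2]`_j.

(** The real part of the product of $\nu(u)$ and the conjugate of $c$; every
    tangent vector of the sphere at $s(u)$ has this form ([nu_comb_surj]). *)
Definition nu_comb u c : 'rV[R]_3 := c.1 *: nu_re u + c.2 *: nu_im u.

Lemma forall_ord3 (P : 'I_3 -> Prop) : P 0 -> P 1 -> P 2 -> forall i, P i.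
Proof.
move=> P0 P1 P2 [[|[|[|//]]]] hi.
- by rewrite (_ : Ordinal hi = 0) //; apply/val_inj.
- by rewrite (_ : Ordinal hi = 1) //; apply/val_inj.
- by rewrite (_ : Ordinal hi = 2) //; apply/val_inj.
Qed.

Lemma row_nu u (z : R[i]) :
  \row_j complex.Re (z * null_vec (toC u) j) =
  nu_comb u (complex.Re z, - complex.Im z).
Proof.
apply/rowP; apply: forall_ord3; rewrite !mxE /null_vec /toC /=;
  case: z => z1 z2; rewrite /=; simpc; rewrite /=; ring.
Qed.

Lemma mulmx_trE x y : x *m y^T = (dot x y)%:M.
Proof. by rewrite [LHS]mx11_scalar. Qed.

Lemma dotE x y :
  dot x y = x 0 0 * y 0 0 + x 0 1 * y 0 1 + x 0 2 * y 0 2.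
Proof.
rewrite /dot mxE !big_ord_recl big_ord0 !mxE addr0 addrA.
by congr (_ * _ + _ * _ + _ * _); congr (_ _ _); apply/val_inj.
Qed.

Lemma dot_stereo u : dot (stereo u) (stereo u) = 1.
Proof.
have := normsq_neq0 u; rewrite dotE !mxE /= /normsq => nz; field; exact: nz.
Qed.

Lemma dot_stereo_re u : dot (stereo u) (nu_re u) = 0.
Proof.
have := normsq_neq0 u; rewrite dotE !mxE /= /normsq => nz; field; exact: nz.
Qed.

Lemma dot_stereo_im u : dot (stereo u) (nu_im u) = 0.
Proof.
have := normsq_neq0 u; rewrite dotE !mxE /= /normsq => nz; field; exact: nz.
Qed.

Lemma dot_re_re u : dot (nu_re u) (nu_re u) = normsq u ^+ 2.
Proof. rewrite dotE !mxE /= /normsq; ring. Qed.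

Lemma dot_im_im u : dot (nu_im u) (nu_im u) = normsq u ^+ 2.
Proof. rewrite dotE !mxE /= /normsq; ring. Qed.

Lemma dot_re_im u : dot (nu_re u) (nu_im u) = 0.
Proof. rewrite dotE !mxE /= /normsq; ring. Qed.

Lemma dotC x y : dot x y = dot y x.
Proof. by rewrite !dotE; ring. Qed.

(** The vectors $s(u)$, $a/(1 + |u|^2)$, $b/(1 + |u|^2)$ form an orthonormal
    basis, so the sum of their projections is the identity. *)
Lemma frame_complete u :
  1%:M = (stereo u)^T *m stereo u + (normsq u ^- 2) *:
     ((nu_re u)^T *m nu_re u + (nu_im u)^T *m nu_im u).
Proof.
have := normsq_neq0 u; rewrite /normsq => nz.
apply/matrixP; apply: forall_ord3; apply: forall_ord3;
  rewrite !mxE !big_ord1 !mxE /= /normsq; field; exact: nz.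
Qed.

(** The matrix $(1 + |u|^2)^{-4} Re(\bar c \nu^T \nu)$. *)
Definition fib u c : 'M[R]_3 := (normsq u ^- 4) *:
   (c.1 *: ((nu_re u)^T *m nu_re u - (nu_im u)^T *m nu_im u)
   + c.2 *: ((nu_re u)^T *m nu_im u + (nu_im u)^T *m nu_re u)).

Lemma dotDr x y z : dot x (y + z) = dot x y + dot x z :> R.
Proof. by rewrite !dotE !mxE; ring. Qed.

Lemma dotZr x (k : R) y : dot x (k *: y) = k * dot x y.
Proof. by rewrite !dotE !mxE; ring. Qed.

Lemma dot_mulmxr g x y : g *m g^T = 1%:M -> dot (x *m g) (y *m g) = dot x y.
Proof.
by move=> gg; rewrite /dot trmx_mul mulmxA -[x *m g *m _]mulmxA gg mulmx1.
Qed.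

Lemma dot_re_comb u c : dot (nu_re u) (nu_comb u c) = c.1 * normsq u ^+ 2.
Proof.
by rewrite dotDr !dotZr dot_re_re dot_re_im mulr0 addr0.
Qed.

Lemma dot_im_comb u c : dot (nu_im u) (nu_comb u c) = c.2 * normsq u ^+ 2.
Proof.
by rewrite dotDr !dotZr dot_im_im dotC dot_re_im mulr0 add0r.
Qed.

Lemma dot_stereo_comb u c : dot (stereo u) (nu_comb u c) = 0.
Proof.
by rewrite dotDr !dotZr dot_stereo_re dot_stereo_im !mulr0 addr0.
Qed.

Lemma nu_comb_inj u : injective (nu_comb u).
Proof.
move=> c d cd; have N0 : normsq u ^+ 2 != 0 by rewrite expf_neq0// normsq_neq0.
have := congr1 (dot (nu_re u)) cd; rewrite !dot_re_comb => /(mulIf N0) e1.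
have := congr1 (dot (nu_im u)) cd; rewrite !dot_im_comb => /(mulIf N0) e2.
by rewrite [c]surjective_pairing [d]surjective_pairing e1 e2.
Qed.

Lemma nu_comb0 u : nu_comb u 0 = 0.
Proof. by rewrite /nu_comb !scale0r addr0. Qed.

Lemma nu_comb_surj u x : dot (stereo u) x = 0 -> exists c, x = nu_comb u c.
Proof.
move=> sx.
exists (dot x (nu_re u) / normsq u ^+ 2, dot x (nu_im u) / normsq u ^+ 2).
rewrite -[LHS]mulmx1 (frame_complete u) mulmxDr mulmxA -[X in _ + X]scalemxAr.
rewrite mulmxDr !mulmxA.
rewrite !mulmx_trE [dot x (stereo u)]dotC sx !mul_scalar_mx scale0r add0r.
by rewrite scalerDr !scalerA /nu_comb /= ![_^-1 * _]mulrC.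
Qed.

Lemma fib_sym u c : (fib u c)^T = fib u c.
Proof.
have TD (M N : 'M[R]_3) : (M + N)^T = M^T + N^T by exact: linearD.
have TZ k (M : 'M[R]_3) : (k *: M)^T = k *: M^T by exact: linearZ.
have TN (M : 'M[R]_3) : (- M)^T = - M^T by exact: linearN.
rewrite /fib TZ TD !TZ !TD TN !trmx_mul !trmxK.
by rewrite [(nu_im u)^T *m nu_re u + _]addrC.
Qed.

(** In complex notation $Re(\bar c \nu) \mapsto (1 + |u|^2)^{-2} Re(c \bar d \nu)$,
    because $\nu \nu^T = 0$ and $\bar\nu \nu^T = 2 (1 + |u|^2)^2$.  Inverting a
    nonzero element of the fibre is thus a complex division. *)
Lemma mul_nu_comb_fib u c d : nu_comb u c *m fib u d =
  (normsq u ^- 2) *: nu_comb u (c.1 * d.1 + c.2 * d.2, c.1 * d.2 - c.2 * d.1).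
Proof.
have N0 := normsq_neq0 u.
rewrite /nu_comb /fib -scalemxAr mulmxDl -!scalemxAl !mulmxDr -!scalemxAr.
rewrite !mulmxDr !mulmxN !mulmxA !mulmx_trE.
rewrite !dot_re_re !dot_im_im [dot (nu_im u) _]dotC !dot_re_im.
rewrite !mul_scalar_mx !scale0r.
apply/rowP => j; rewrite !mxE /=; field; exact: N0.
Qed.

Lemma mul_stereo_fib u c : stereo u *m fib u c = 0.
Proof.
rewrite /fib -[LHS]scalemxAr mulmxDr.
rewrite -[X in X + _]scalemxAr -[X in _ + X]scalemxAr mulmxBr mulmxDr.
rewrite !mulmxA !mulmx_trE dot_stereo_re dot_stereo_im !mul_scalar_mx.
by rewrite !scale0r subrr !addr0 !scaler0 addr0 scaler0.
Qed.

Lemma mxtrace_trmul x y : \tr (x^T *m y) = dot x y.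
Proof. by rewrite mxtrace_mulC mulmx_trE mxtrace_scalar mulr1n dotC. Qed.

Lemma tr_fib u c : \tr (fib u c) = 0.
Proof.
rewrite /fib mxtraceZ mxtraceD !mxtraceZ linearB linearD /= !mxtrace_trmul.
rewrite dot_re_re dot_im_im [dot (nu_im u) _]dotC dot_re_im; ring.
Qed.

Lemma fib_inj u : injective (fib u).
Proof.
move=> c d cd; have := congr1 (mulmx (nu_comb u (1, 0))) cd.
have N0 : normsq u ^- 2 != 0 by rewrite invr_neq0// expf_neq0// normsq_neq0.
rewrite !mul_nu_comb_fib => /(scalerI N0)/nu_comb_inj /=.
by rewrite !mul1r !mul0r !addr0 !subr0 -!surjective_pairing.
Qed.

Lemma fib0 u : fib u 0 = 0.
Proof. by rewrite /fib !scale0r addr0 scaler0. Qed.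

Lemma fibD u c d : fib u (c + d) = fib u c + fib u d.
Proof. by rewrite /fib -scalerDr !scalerDl addrACA. Qed.

Lemma fibZ u k c : fib u (k *: c) = k *: fib u c.
Proof.
rewrite /fib [RHS]scalerA [k * _]mulrC -[RHS]scalerA.
by rewrite [k *: (_ + _)]scalerDr !scalerA.
Qed.

(** In the basis $a, b$ of the tangent plane a symmetric form is given by its
    values on $(a, a)$, $(a, b)$ and $(b, b)$, and the trace condition says that
    the first and the last are opposite. *)
Lemma fib_surj u (A : 'M[R]_3) : A^T = A -> stereo u *m A = 0 -> \tr A = 0 ->
  exists c, A = fib u c.
Proof.
move=> symA sA trA.
set a := nu_re u; set b := nu_im u; set k := normsq u ^- 2.
have As : A *m (stereo u)^T = 0.
  by rewrite -[LHS]trmxK trmx_mul trmxK symA sA trmx0.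
pose P := k *: (a^T *m a + b^T *m b).
have PA : A = P *m A.
  rewrite -[LHS]mul1mx (frame_complete u) mulmxDl -mulmxA sA mulmx0 add0r.
  by [].
have AP : A = A *m P.
  by rewrite -[LHS]mulmx1 (frame_complete u) mulmxDr mulmxA As mul0mx add0r.
pose f (x y : 'rV[R]_3) := (x *m A *m y^T) 0 0.
have fE x y : x *m A *m y^T = (f x y)%:M by exact: mx11_scalar.
have fC x y : f x y = f y x.
  have -> : f x y = (x *m A *m y^T)^T 0 0 by rewrite mxE.
  by rewrite !trmx_mul trmxK symA mulmxA.
have AE : A = k ^+ 2 *: (f a a *: (a^T *m a) + f a b *: (a^T *m b) +
    (f a b *: (b^T *m a) + f b b *: (b^T *m b))).
  rewrite {1}AP {1}PA /P -[LHS]scalemxAr -[X in k *: (X *m _)]scalemxAl.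
  rewrite -[X in k *: X = _]scalemxAl scalerA -expr2; congr (_ *: _).
  have E (x y z w : 'rV[R]_3) :
      x^T *m y *m A *m (z^T *m w) = f y z *: (x^T *m w).
    rewrite mulmxA -(mulmxA x^T y) -(mulmxA x^T) fE mul_mx_scalar.
    by rewrite -scalemxAl.
  by rewrite !mulmxDl !mulmxDr !E (fC b a).
have k0 : k != 0 by rewrite invr_neq0// expf_neq0// normsq_neq0.
have fbb : f b b = - f a a.
  apply/eqP; rewrite -addr_eq0 addrC; apply/eqP.
  have := trA; rewrite {1}AE mxtraceZ !mxtraceD !mxtraceZ !mxtrace_trmul.
  rewrite /a /b [dot (nu_im u) (nu_re u)]dotC !dot_re_im dot_re_re dot_im_im.
  rewrite !mulr0 addr0 add0r -mulrDl => /eqP.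
  rewrite mulf_eq0 expf_eq0 (negbTE k0) /= mulf_eq0 expf_eq0.
  by rewrite (negbTE (normsq_neq0 u)) orbF => /eqP.
exists (f a a, f a b).
rewrite {1}AE /fib fbb -/a -/b /k exprVn -exprM; congr (_ *: _).
rewrite /= scaleNr scalerBr scalerDr addrACA [RHS]addrACA.
by rewrite [X in _ = _ + X]addrC addrACA.
Qed.

End Frame.

(** * The parametrization of the bundle *)

Section Chart.
Variable R : realType.
Implicit Types (u d c w : plane R) (g : 'M[R]_3).

(** With [g] the identity this is the chart over the complement of $-e_3$, with
    [g] a half turn the chart over the complement of $e_3$. *)
Definition rotated_param g (x : plane R * plane R) : ambient R :=
  (stereo x.1 *m g, g^T *m fib x.1 x.2 *m g).

(** The differential of [stereo]; see [is_derive_stereo]. *)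
Definition dstereo u d : 'rV[R]_3 := (- 2 / normsq u ^+ 2) *: nu_comb u d.

Lemma rotated_param_Qset g x : g *m g^T = 1%:M -> Qset (rotated_param g x).
Proof.
move=> gg; split => /=.
- by rewrite /sphere /= dot_mulmxr// dot_stereo.
- by rewrite !trmx_mul trmxK fib_sym mulmxA.
- by rewrite !mulmxA -(mulmxA _ g) gg mulmx1 mul_stereo_fib mul0mx.
- by rewrite -mulmxA mxtrace_mulC -mulmxA gg mulmx1 tr_fib.
Qed.

Lemma orthogonal_conj_inj g : g *m g^T = 1%:M ->
  injective (fun A : 'M[R]_3 => g^T *m A *m g).
Proof.
move=> gg A B /= /(congr1 (fun M => g *m M *m g^T)).
by rewrite !mulmxA gg !mul1mx -!mulmxA gg !mulmx1.
Qed.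

Lemma rotated_param_fibre0 g x : g *m g^T = 1%:M ->
  (rotated_param g x).2 = 0 -> x.2 = 0.
Proof.
move=> gg /= h; apply: (@fib_inj R x.1); apply: (orthogonal_conj_inj gg).
by rewrite /= fib0 mulmx0 mul0mx.
Qed.

Lemma rotated_param_surj g u (p : ambient R) : g *m g^T = 1%:M -> Qset p ->
  p.1 = stereo u *m g -> exists c, p = rotated_param g (u, c).
Proof.
move=> gg [_ symA sA trA] p1; have gg' := mulmx1C gg.
have [] := @fib_surj R u (g *m p.2 *m g^T).
- by rewrite !trmx_mul trmxK symA mulmxA.
- by rewrite !mulmxA -p1 sA mul0mx.
- by rewrite -mulmxA mxtrace_mulC -mulmxA gg' mulmx1.
move=> c cE; exists c; rewrite [LHS]surjective_pairing /rotated_param p1 /= -cE.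
by rewrite !mulmxA gg' mul1mx -mulmxA gg' mulmx1.
Qed.

Lemma toC_eq0 c : (toC c == 0) = (c == 0).
Proof. by case: c => c1 c2; rewrite eq_complex /= -pair_eqE. Qed.

Lemma toCK : cancel (@toC R) (@ofC R). Proof. by case. Qed.
Lemma ofCK : cancel (@ofC R) (@toC R). Proof. by case. Qed.

Lemma mul_nu_comb_fib_inv u d c : c != 0 ->
  let z := - 2 * toC d / toC c in
  nu_comb u (complex.Re z, - complex.Im z) *m fib u c = dstereo u d.
Proof.
move=> c0 z; rewrite mul_nu_comb_fib /dstereo [- 2 / _]mulrC -[RHS]scalerA /=.
congr (_ *: _).
have c0' : toC c != 0 by rewrite toC_eq0.
have zc : z * toC c = - 2 * toC d by rewrite /z divfK.
have -> : (complex.Re z * c.1 + - complex.Im z * c.2,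
   complex.Re z * c.2 - - complex.Im z * c.1) = (-2 : R) *: d.
  rewrite -[LHS]/((_, _) : plane R) -[RHS]toCK.
  have -> : toC ((-2 : R) *: d) = z * toC c.
    by rewrite zc; case: (d) => d1 d2; rewrite /toC /=; simpc; congr (_ +i* _).
  case: (z) => z1 z2; rewrite /toC /ofC; simpc; congr (_, _); ring.
by rewrite /nu_comb /= scalerDr !scalerA.
Qed.

(** In complex notation the matrix multiplies by $c$, up to conjugation, so it
    is invertible on the tangent plane; the proof recovers the two components of
    the vector from the two components of the product. *)
Lemma fib_ker u c (x : 'rV[R]_3) : c != 0 -> dot (stereo u) x = 0 ->
  x *m fib u c = 0 -> x = 0.
Proof.
move=> c0 /nu_comb_surj [w ->]; rewrite mul_nu_comb_fib => /eqP.
rewrite scaler_eq0 invr_eq0 expf_eq0 (negbTE (normsq_neq0 u)) /= => /eqP.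
rewrite -[RHS](nu_comb0 u) => /nu_comb_inj.
move=> -[] e1 e2.
have c2 : 0 < c.1 ^+ 2 + c.2 ^+ 2.
  rewrite lt_def addr_ge0 ?sqr_ge0// andbT paddr_eq0 ?sqr_ge0// !sqrf_eq0.
  by move: c0; rewrite [c]surjective_pairing -pair_eqE.
have [w1 w2] : w.1 = 0 /\ w.2 = 0.
  split; apply/eqP; rewrite -(mulIr_eq0 _ (mulIf (lt0r_neq0 c2))); apply/eqP.
  - transitivity (c.1 * (w.1 * c.1 + w.2 * c.2) +
                  c.2 * (w.1 * c.2 - w.2 * c.1)).
      ring.
    by rewrite e1 e2 !mulr0 addr0.
  - transitivity (c.2 * (w.1 * c.1 + w.2 * c.2) -
                  c.1 * (w.1 * c.2 - w.2 * c.1)).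
      ring.
    by rewrite e1 e2 !mulr0 subr0.
by rewrite [w]surjective_pairing w1 w2 nu_comb0.
Qed.

(** The coordinate $q$ is defined by this formula; here it is checked for the
    explicit parametrization, in rotated position. *)
Lemma fibre_inv_rotated g u d c : g *m g^T = 1%:M -> c != 0 ->
  fibre_inv (rotated_param g (u, c)) (dstereo u d *m g) =
  (\row_j complex.Re (- 2 * toC d / toC c * null_vec (toC u) j)) *m g.
Proof.
move=> gg c0; have gg' := mulmx1C gg.
rewrite row_nu; set x := nu_comb _ _.
rewrite /fibre_inv; case: xgetP => [y _ [/= sy yA]|/(_ (x *m g)) []]; last first.
  split=> /=; first by rewrite dot_mulmxr// dot_stereo_comb.
  by rewrite !mulmxA -(mulmxA _ g) gg mulmx1 mul_nu_comb_fib_inv.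
have yE : y = (y *m g^T) *m g by rewrite -mulmxA gg' mulmx1.
rewrite yE dot_mulmxr// in sy.
rewrite yE; congr (_ *m g); apply/eqP; rewrite -subr_eq0; apply/eqP.
apply: (@fib_ker u c _ c0).
  by rewrite dotDr sy add0r -scaleN1r dotZr dot_stereo_comb mulr0.
rewrite mulmxBl mul_nu_comb_fib_inv//.
have := congr1 (mulmx^~ g^T) yA.
by rewrite !mulmxA -!(mulmxA _ g) gg !mulmx1 => ->; rewrite subrr.
Qed.

End Chart.

(** * Directional derivatives *)

Lemma is_derive_affine (R : realType) (V W : normedModType R) (f : V -> W)
    x v D :
  (forall h : R, f (h *: v + x) = h *: D + f x) -> is_derive x v f D.
Proof.
move=> fE.
have H : h^-1 *: ((f \o shift x) (h *: v) - f x) @[h --> (0:R)^'] --> D.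
  apply: cvg_near_cst; near=> h => /=.
  have h0 : h != 0 by near: h; exact: nbhs_dnbhs_neq.
  by rewrite fE addrK scalerA mulVf ?scale1r.
by apply: DeriveDef; [apply/cvg_ex; exists D|exact: cvg_lim H].
Unshelve. all: by end_near. Qed.

Lemma differentiable_matrix (R : realType) (V : normedModType R) m n
    (F : V -> 'M[R]_(m, n)) x :
  (forall i j, differentiable (fun y => F y i j) x) -> differentiable F x.
Proof.
move=> dF.
have -> : F = \sum_i \sum_j (fun y => F y i j *: delta_mx i j).
  apply/funext => y; rewrite [LHS]matrix_sum_delta fct_sumE.
  by apply: eq_bigr => i _; rewrite fct_sumE.
by do 2!(apply: differentiable_sum => ?); exact: differentiableZl.
Qed.

Lemma is_derive_matrix (R : realType) (V : normedModType R) m n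
    (F : V -> 'M[R]_(m, n)) x v (D : 'M[R]_(m, n)) :
  (forall i j, is_derive x v (fun y => F y i j) (D i j)) -> is_derive x v F D.
Proof.
move=> H; have dF : derivable F x v.
  by apply/derivable_mxP => i j; case: (H i j).
apply: DeriveDef => //; rewrite derive_mx//; apply/matrixP => i j; rewrite mxE.
by case: (H i j).
Qed.

Lemma is_derive_inv (R : realType) (V : normedModType R) (f : V -> R) x v D :
  f x != 0 -> is_derive x v f D ->
  is_derive x v (fun y => (f y)^-1) (- (f x) ^- 2 * D).
Proof.
move=> f0 [df <-]; apply: DeriveDef; first exact: derivableV.
exact: deriveV.
Qed.

Lemma is_derive_mul (R : realType) (V : normedModType R) (f f' : V -> R)
    x v D D' :
  is_derive x v f D -> is_derive x v f' D' ->
  is_derive x v (fun y => f y * f' y) (D * f' x + f x * D').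
Proof.
move=> H H'; apply: (is_derive_eq (is_deriveM H H')).
by rewrite /GRing.scale /= addrC [X in X + _]mulrC.
Qed.

Lemma is_derive_fst (R : realType) (V W : normedModType R) (x v : V * W) :
  is_derive x v (fun y => y.1) v.1.
Proof. exact: is_derive_affine. Qed.

Lemma is_derive_snd (R : realType) (V W : normedModType R) (x v : V * W) :
  is_derive x v (fun y => y.2) v.2.
Proof. exact: is_derive_affine. Qed.

Lemma is_derive_stereo (R : realType) (u d : plane R) :
  is_derive u d (@stereo R) (dstereo u d).
Proof.
have N0 := normsq_neq0 u.
have d1 := is_derive_fst u d; have d2 := is_derive_snd u d.
have dc (c : R) := is_derive_cst c u d.
have dn : is_derive u d (@normsq R) (2 * (u.1 * d.1 + u.2 * d.2)).
  apply: (is_derive_eq (is_deriveD (dc 1)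
    (is_deriveD (is_derive_mul d1 d1) (is_derive_mul d2 d2)))).
  by rewrite /=; ring.
have e (f : plane R -> R) (i : 'I_3) D : is_derive u d f D ->
    (forall y, stereo y 0 i = (normsq y)^-1 * f y) ->
    - normsq u ^- 2 * (2 * (u.1 * d.1 + u.2 * d.2)) * f u + (normsq u)^-1 * D =
      dstereo u d 0 i ->
    is_derive u d (fun y => stereo y 0 i) (dstereo u d 0 i).
  move=> Hf /funext -> <-; exact: is_derive_mul (is_derive_inv N0 dn) Hf.
have dl c (f : plane R -> R) D : is_derive u d f D ->
    is_derive u d (fun y => c * f y) (c * D) by exact: is_deriveZ.
apply: is_derive_matrix => i; apply: forall_ord3; rewrite {i}ord1.
- apply: (e _ _ _ (dl (-2) _ _ d1)) => [y|]; rewrite !mxE /= /normsq //.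
  by rewrite -/(normsq u); move: N0; rewrite /normsq => N0; field.
- apply: (e _ _ _ (dl (-2) _ _ d2)) => [y|]; rewrite !mxE /= /normsq //.
  by rewrite -/(normsq u); move: N0; rewrite /normsq => N0; field.
- have d3 : is_derive u d (fun y => 2 - normsq y)
      (- (2 * (u.1 * d.1 + u.2 * d.2))).
    by apply: (is_derive_eq (is_deriveB (dc 2) dn)); rewrite sub0r.
  apply: (e _ _ _ d3) => [y|]; rewrite !mxE /= /normsq.
    by congr (_ * _); ring.
  by move: N0; rewrite /normsq => N0; field.
Qed.

Lemma eq_differentiable (R : realType) (V W : normedModType R) (f h : V -> W)
    x :
  differentiable f x -> (forall y, h y = f y) -> differentiable h x.
Proof. by move=> df /funext ->. Qed.

(** * Differentiability of the parametrization *)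

Definition differentiable_entries (R : realType) (V : normedModType R) m n
    (F : V -> 'M[R]_(m, n)) x := forall i j, differentiable (fun y => F y i j) x.

Section DifferentiableEntries.
Variables (R : realType) (V : normedModType R) (x : V).

Lemma differentiable_entries_cst m n (A : 'M[R]_(m, n)) :
  differentiable_entries (fun _ : V => A) x.
Proof. by move=> i j; exact: differentiable_cst. Qed.

Lemma differentiable_entriesT m n (F : V -> 'M[R]_(m, n)) :
  differentiable_entries F x -> differentiable_entries (fun y => (F y)^T) x.
Proof.
by move=> dF i j; apply: (eq_differentiable (dF j i)) => y; rewrite mxE.
Qed.

Lemma differentiable_entriesM m n p (F : V -> 'M[R]_(m, n))
    (G : V -> 'M[R]_(n, p)) :
  differentiable_entries F x -> differentiable_entries G x ->
  differentiable_entries (fun y => F y *m G y) x.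
Proof.
move=> dF dG i j.
have -> : (fun y => (F y *m G y) i j) =
    \sum_k (fun y => F y i k) * (fun y => G y k j).
  by apply/funext => y; rewrite mxE fct_sumE.
by apply: differentiable_sum => k; exact: differentiableM.
Qed.

Lemma differentiable_entriesD m n (F G : V -> 'M[R]_(m, n)) :
  differentiable_entries F x -> differentiable_entries G x ->
  differentiable_entries (fun y => F y + G y) x.
Proof.
move=> dF dG i j.
apply: (eq_differentiable (differentiableD (dF i j) (dG i j))) => y.
by rewrite mxE.
Qed.

Lemma differentiable_entriesZ m n (f : V -> R) (F : V -> 'M[R]_(m, n)) :
  differentiable f x -> differentiable_entries F x ->
  differentiable_entries (fun y => f y *: F y) x.
Proof.
move=> df dF i j.
by apply: (eq_differentiable (differentiableM df (dF i j))) => y; rewrite mxE.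
Qed.

End DifferentiableEntries.

Section DifferentiableParam.
Variables (R : realType) (x : plane R * plane R).

Let d11 : differentiable (fun y : plane R * plane R => y.1.1) x.
Proof.
apply: (@differentiable_comp _ _ _ _ fst fst);
  apply: linear_differentiable => y.
  exact: cvg_fst.
exact: cvg_fst.
Qed.
Let d12 : differentiable (fun y : plane R * plane R => y.1.2) x.
Proof.
apply: (@differentiable_comp _ _ _ _ fst snd);
  apply: linear_differentiable => y.
  exact: cvg_fst.
exact: cvg_snd.
Qed.
Let d21 : differentiable (fun y : plane R * plane R => y.2.1) x.
Proof.
apply: (@differentiable_comp _ _ _ _ snd fst);
  apply: linear_differentiable => y.
  exact: cvg_snd.
exact: cvg_fst.
Qed.
Let d22 : differentiable (fun y : plane R * plane R => y.2.2) x.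
Proof.
apply: (@differentiable_comp _ _ _ _ snd snd);
  apply: linear_differentiable => y.
  exact: cvg_snd.
exact: cvg_snd.
Qed.
Let dcst (c : R) : differentiable (fun y : plane R * plane R => c) x.
Proof. exact: differentiable_cst. Qed.

Let dsq1 := differentiableM d11 d11.
Let dsq2 := differentiableM d12 d12.

Let dN : differentiable (fun y : plane R * plane R => (normsq y.1)^-1) x.
Proof.
apply: differentiableV; last exact: normsq_neq0.
exact: differentiableD (dcst 1) (differentiableD dsq1 dsq2).
Qed.

Let dstereo_entries :
  differentiable_entries (fun y : plane R * plane R => stereo y.1) x.
Proof.
apply: (differentiable_entriesZ dN) => i; apply: forall_ord3.
- apply: (eq_differentiable (differentiableM (dcst (-2)) d11)) => y.
  by rewrite mxE.
- apply: (eq_differentiable (differentiableM (dcst (-2)) d12)) => y.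
  by rewrite mxE.
- by apply: (eq_differentiable (differentiableB (dcst 1)
    (differentiableD dsq1 dsq2))) => y; rewrite mxE.
Qed.

Let dnu_re : differentiable_entries (fun y : plane R * plane R => nu_re y.1) x.
Proof.
move=> i; apply: forall_ord3.
- by apply: (eq_differentiable (differentiableD (differentiableB (dcst 1) dsq1)
    dsq2)) => y; rewrite mxE.
- by apply: (eq_differentiable
    (differentiableM (differentiableM (dcst (-2)) d11) d12)) => y; rewrite mxE.
- by apply: (eq_differentiable (differentiableM (dcst 2) d11)) => y; rewrite mxE.
Qed.

Let dnu_im : differentiable_entries (fun y : plane R * plane R => nu_im y.1) x.
Proof.
move=> i; apply: forall_ord3.
- by apply: (eq_differentiable
    (differentiableM (differentiableM (dcst (-2)) d11) d12)) => y; rewrite mxE.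
- by apply: (eq_differentiable (differentiableB (differentiableD (dcst 1) dsq1)
    dsq2)) => y; rewrite mxE.
- by apply: (eq_differentiable (differentiableM (dcst 2) d12)) => y; rewrite mxE.
Qed.

Let dfib : differentiable_entries (fun y : plane R * plane R => fib y.1 y.2) x.
Proof.
have dre := differentiable_entriesT dnu_re.
have dim := differentiable_entriesT dnu_im.
apply: differentiable_entriesZ.
  by apply: (eq_differentiable (differentiableX 3 dN)) => y; rewrite -exprVn.
apply: differentiable_entriesD; apply: differentiable_entriesZ => //.
  apply: differentiable_entriesD; first exact: differentiable_entriesM.
  move=> i j; apply: (eq_differentiable
    (differentiableN (differentiable_entriesM dim dnu_im i j))) => y.
  by rewrite [LHS]mxE.
by apply: differentiable_entriesD; exact: differentiable_entriesM.
Qed.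

Lemma differentiable_rotated_param g : differentiable (rotated_param g) x.
Proof.
apply: differentiable_pair; apply: differentiable_matrix.
  exact: differentiable_entriesM (differentiable_entries_cst _ _).
apply: differentiable_entriesM (differentiable_entries_cst _ _).
exact: differentiable_entriesM (differentiable_entries_cst _ _) _.
Qed.

End DifferentiableParam.

(** * The differential of the parametrization *)

Lemma is_derive_comp_fst (R : realType) (V W W' : normedModType R)
    (f : V -> W * W') x v D :
  is_derive x v f D -> is_derive x v (fun y => (f y).1) D.1.
Proof.
move=> [df <-].
have H : h^-1 *: (((fun y => (f y).1) \o shift x) (h *: v) - (f x).1)
    @[h --> (0:R)^'] --> ('D_v f x).1.
  apply: (@cvg_comp _ _ _ _ fst _ _ _ df).
  exact: (@cvg_fst _ _ _ (nbhs ('D_v f x).2)).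
by apply: DeriveDef; [apply/cvg_ex; exists ('D_v f x).1|exact: cvg_lim H].
Qed.

Lemma is_derive_of_fst (R : realType) (V V' W : normedModType R) (f : V -> W)
    (x v : V * V') D :
  is_derive x.1 v.1 f D -> is_derive x v (fun y => f y.1) D.
Proof. by move=> [df <-]; apply: DeriveDef. Qed.

Lemma is_derive_entry (R : realType) (V : normedModType R) m n
    (F : V -> 'M[R]_(m, n)) x v (D : 'M[R]_(m, n)) i j :
  is_derive x v F D -> is_derive x v (fun y => F y i j) (D i j).
Proof.
move=> [dF <-]; apply: DeriveDef; first exact: (iffLR (derivable_mxP _ _ _)).
by rewrite derive_mx// mxE.
Qed.

Lemma is_derive_mulmxr (R : realType) (V : normedModType R) m n p
    (F : V -> 'M[R]_(m, n)) (B : 'M[R]_(n, p)) x v (D : 'M[R]_(m, n)) :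
  is_derive x v F D -> is_derive x v (fun y => F y *m B) (D *m B).
Proof.
move=> dF; apply: is_derive_matrix => i j.
have -> : (fun y => (F y *m B) i j) = \sum_k (fun y => F y i k * B k j).
  by apply/funext => y; rewrite mxE fct_sumE.
rewrite mxE; apply: is_derive_sum => k.
apply: (is_derive_eq (is_derive_mul (is_derive_entry i k dF)
  (is_derive_cst (B k j) x v))).
by rewrite mulr0 addr0.
Qed.

Lemma is_derive_along_line (R : realType) (V W : normedModType R) (f : V -> W)
    x v D :
  is_derive x v f D -> is_derive (0 : R) 1 (fun t => f (t *: v + x)) D.
Proof.
move=> [df <-].
have H : h^-1 *: (((fun t : R => f (t *: v + x)) \o shift 0) (h *: 1) -
    f ((0 : R) *: v + x)) @[h --> (0:R)^'] --> 'D_v f x.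
  rewrite scale0r add0r; move: df; apply: cvg_trans; apply: near_eq_cvg.
  by near=> h => /=; rewrite addr0 /GRing.scale/= mulr1.
by apply: DeriveDef; [apply/cvg_ex; exists ('D_v f x)|exact: cvg_lim H].
Unshelve. all: by end_near. Qed.

Section DParam.
Variables (R : realType) (g : 'M[R]_3).
Hypothesis gg : g *m g^T = 1%:M.
Implicit Types (x xi eta : plane R * plane R).

Lemma is_derive_param x xi :
  is_derive x xi (rotated_param g) ('D_xi (rotated_param g) x).
Proof.
apply: DeriveDef => //; apply: diff_derivable; exact: differentiable_rotated_param.
Qed.

Lemma derive_paramD x xi eta : 'D_(xi + eta) (rotated_param g) x =
  'D_xi (rotated_param g) x + 'D_eta (rotated_param g) x.
Proof.
by rewrite !deriveE ?linearD//; exact: differentiable_rotated_param.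
Qed.

Lemma derive_paramN x xi :
  'D_(- xi) (rotated_param g) x = - 'D_xi (rotated_param g) x.
Proof.
by rewrite !deriveE ?linearN//; exact: differentiable_rotated_param.
Qed.

Lemma derive_param_fst x xi :
  ('D_xi (rotated_param g) x).1 = dstereo x.1 xi.1 *m g.
Proof.
have [_ <-] := is_derive_comp_fst (is_derive_param x xi).
have := is_derive_of_fst (is_derive_stereo x.1 xi.1).
by move=> /(is_derive_mulmxr g) [_ <-].
Qed.

Lemma derive_param_vertical x c :
  'D_(0, c) (rotated_param g) x = (0, g^T *m fib x.1 c *m g).
Proof.
apply: derive_val; apply: is_derive_affine => h.
rewrite /rotated_param /= scaler0 add0r.
have -> : g^T *m fib x.1 (h *: c + x.2) *m g =
    h *: (g^T *m fib x.1 c *m g) + g^T *m fib x.1 x.2 *m g.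
  rewrite fibD fibZ mulmxDr mulmxDl; congr (_ + _).
  by rewrite -scalemxAr -scalemxAl.
by rewrite [RHS]surjective_pairing /= scaler0 add0r.
Qed.

Lemma derive_param_TQ x xi :
  'D_xi (rotated_param g) x \in TQ (rotated_param g x).
Proof.
apply/TQ_velocity; first exact: rotated_param_Qset.
exists (fun t => rotated_param g (t *: xi + x)); split.
- by near=> t; exact: rotated_param_Qset.
- by rewrite scale0r add0r.
- exact: is_derive_along_line (is_derive_param x xi).
Unshelve. all: by end_near. Qed.

Lemma dstereo_inj u : injective (@dstereo R u).
Proof.
move=> c d /scalerI h; apply: (@nu_comb_inj R u); apply: h.
by rewrite mulf_neq0 ?oppr_eq0 ?pnatr_eq0// invr_neq0// expf_neq0// normsq_neq0.
Qed.

Lemma dstereo0 u : @dstereo R u 0 = 0.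
Proof. by rewrite /dstereo nu_comb0 scaler0. Qed.

Lemma dstereo_surj (u : plane R) v :
  dot (stereo u) v = 0 -> exists d, v = dstereo u d.
Proof.
move=> /nu_comb_surj [c ->]; exists ((- 2 / normsq u ^+ 2)^-1 *: c).
have k0 : - 2 / normsq u ^+ 2 != 0.
  by rewrite mulf_neq0 ?oppr_eq0 ?pnatr_eq0// invr_neq0// expf_neq0// normsq_neq0.
by rewrite /dstereo /nu_comb /= scalerDr !scalerA !mulVKf.
Qed.

Lemma mulmx_orthogonal_inj n : injective (fun A : 'M[R]_(n, 3) => A *m g).
Proof. by move=> A B /(congr1 (mulmx^~ g^T)); rewrite -!mulmxA gg !mulmx1. Qed.

Lemma derive_param_ker x xi : 'D_xi (rotated_param g) x = 0 -> xi = 0.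
Proof.
move=> h; have := congr1 fst h; rewrite derive_param_fst /=.
rewrite -[RHS](mul0mx _ g) => /mulmx_orthogonal_inj.
rewrite -(dstereo0 x.1) => /dstereo_inj xi1.
move: h; rewrite [xi]surjective_pairing xi1 derive_param_vertical => -[].
rewrite -[RHS](mul0mx _ g) -[X in _ = X *m _](mulmx0 _ g^T) -(fib0 x.1).
by move=> /(orthogonal_conj_inj gg)/fib_inj ->.
Qed.

Lemma derive_param_inj x : injective (fun xi => 'D_xi (rotated_param g) x).
Proof.
move=> xi eta /= h; apply/eqP; rewrite -subr_eq0; apply/eqP.
by apply: (@derive_param_ker x); rewrite derive_paramD derive_paramN h subrr.
Qed.

(** The component of [v] along the sphere is $ds(d)$ for some $d$; what remains
    after subtracting the image of $(d, 0)$ is tangent to the fibre, and the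
    fibre is a vector space parametrized linearly by [fib]. *)
Lemma derive_param_surj x v : v \in TQ (rotated_param g x) ->
  exists xi, 'D_xi (rotated_param g) x = v.
Proof.
move=> vT; have gg' := mulmx1C gg.
have /mem_TQ [/= v1 _ _ _] := vT.
have [|d dE] := @dstereo_surj x.1 (v.1 *m g^T).
  by rewrite -(dot_mulmxr _ _ gg) -mulmxA gg' mulmx1.
pose w := v - 'D_(d, 0) (rotated_param g) x.
have wT : w \in TQ (rotated_param g x) by rewrite memvB// derive_param_TQ.
have w1 : w.1 = 0.
  by rewrite /w /= derive_param_fst /= -dE -mulmxA gg' mulmx1 subrr.
have /mem_TQ [_ symw sw trw] := wT; rewrite w1 mul0mx add0r /= in sw.
have [] := @fib_surj R x.1 (g *m w.2 *m g^T).
- by rewrite !trmx_mul trmxK symw mulmxA.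
- by rewrite !mulmxA sw mul0mx.
- by rewrite -mulmxA mxtrace_mulC -mulmxA gg' mulmx1.
move=> c cE; exists ((d, 0) + (0, c)).
rewrite derive_paramD derive_param_vertical -cE !mulmxA gg' mul1mx.
rewrite -mulmxA gg' mulmx1.
by rewrite -w1 -surjective_pairing /w addrC subrK.
Qed.

End DParam.

(** * The two charts *)

Section Charts.
Variable R : realType.
Implicit Types (u d c w : plane R) (x : plane R * plane R) (p : ambient R).

Lemma one_orthogonal : 1%:M *m (1%:M : 'M[R]_3)^T = 1%:M.
Proof. by rewrite trmx1 mulmx1. Qed.

Lemma derive_stereo u d : 'D_d (@stereo R) u = dstereo u d.
Proof. by have [] := is_derive_stereo u d. Qed.

Lemma conj_pair_inj :
  injective (fun z : R[i] => (complex.Re z, - complex.Im z)).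
Proof. by move=> [? ?] [? ?] [-> /oppr_inj ->]. Qed.

(** Uniqueness: a point over $s(u)$ is [rotated_param 1%:M (u, a)] for some $a$,
    and then the defining formula of the coordinate gives $-2/a = -2/q$. *)
Lemma has_coordP x p : has_coord x p <-> p = rotated_param 1%:M x.
Proof.
have Q1 := rotated_param_Qset x one_orthogonal.
case: x Q1 => u c Q1; rewrite /has_coord; split=> [[Qp p1]|->].
  have [|a pE] := rotated_param_surj one_orthogonal Qp (u := u).
    by rewrite mulmx1.
  rewrite toC_eq0; case: ifP => [/eqP c0 p2|/negbT c0 [p2 inv]].
    rewrite pE in p2 *; have /= a0 := rotated_param_fibre0 one_orthogonal p2.
    by rewrite a0 c0.
  have a0 : a != 0.
    apply/eqP => a0; move/eqP: p2; apply.
    by rewrite pE a0 /= fib0 mulmx0 mul0mx.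
  rewrite pE; suff -> : c = a by [].
  have := inv (1, 0); rewrite derive_stereo pE -[dstereo _ _]mulmx1.
  rewrite fibre_inv_rotated ?one_orthogonal// mulmx1 !row_nu.
  move=> /nu_comb_inj/conj_pair_inj E.
  have n0 : - 2 * toC ((1, 0) : plane R) != 0.
    by rewrite mulf_neq0 ?toC_eq0 ?oppr_eq0 ?pnatr_eq0// -pair_eqE /= oner_eq0.
  by rewrite -[c]toCK -[a]toCK; move/(mulfI n0)/invr_inj: E => ->.
split=> //=; first by rewrite mulmx1.
rewrite toC_eq0; case: ifP => [/eqP ->|/negbT c0].
  by rewrite fib0 mulmx0 mul0mx.
split.
  apply/eqP => h.
  have h' : (rotated_param 1%:M (u, c)).2 = 0 by [].
  by have /eqP := rotated_param_fibre0 one_orthogonal h'; apply/negP.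
move=> d; rewrite derive_stereo -[dstereo _ _]mulmx1.
by rewrite fibre_inv_rotated ?one_orthogonal// mulmx1.
Qed.

Lemma param_uE : @param_u R = rotated_param 1%:M.
Proof.
apply/funext => x; rewrite /param_u.
case: xgetP => [p _ /has_coordP //|/(_ (rotated_param 1%:M x)) []].
exact/has_coordP.
Qed.

Definition half_turn : 'M[R]_3 := diag_mx (\row_j [:: 1; -1; -1]`_j).

Lemma half_turn_orthogonal : half_turn *m half_turn^T = 1%:M.
Proof.
rewrite tr_diag_mx mulmx_diag; apply/matrixP => i j; rewrite !mxE.
case: eqP => // -> {i}.
by rewrite !mulr1n; move: j; apply: forall_ord3; rewrite /= ?mulrNN mulr1.
Qed.

Lemma mul_half_turnE m (A : 'M[R]_(m, 3)) i j :
  (A *m half_turn) i j = A i j * [:: 1; -1; -1]`_j.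
Proof. by rewrite mul_mx_diag !mxE. Qed.

Section Inversion.
Variable v : plane R.
Hypothesis v0 : v != 0.
Let m := v.1 ^+ 2 + v.2 ^+ 2.

Let m0 : m != 0.
Proof.
rewrite /m paddr_eq0 ?sqr_ge0// !sqrf_eq0.
by move: v0; rewrite [v]surjective_pairing -pair_eqE.
Qed.

Let N0 : 1 + m != 0. Proof. exact: (normsq_neq0 v). Qed.

Let inv : plane R := ofC (toC v)^-1.

Let invE : inv = (v.1 / m, - v.2 / m).
Proof. by rewrite /inv /ofC /toC /= mulNr. Qed.

Lemma stereo_inv : stereo inv = stereo v *m half_turn.
Proof.
have P0 : m ^+ 2 + (v.1 ^+ 2 + (- v.2) ^+ 2) != 0.
  by rewrite sqrrN -/m (_ : _ + m = m * (1 + m)) ?mulf_neq0//; ring.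
rewrite invE; apply/rowP => j; rewrite mul_half_turnE; move: j.
apply: forall_ord3; rewrite !mxE /=; move: m0 N0 P0; rewrite /m => m1 N1 P1;
  by field; rewrite m1 N1 P1.
Qed.

(* The real and the imaginary part of $- v^{-2}$, the factor that relates the
   null vectors at $1/v$ and at $v$. *)
Let al := - (v.1 ^+ 2 - v.2 ^+ 2) / m ^+ 2.
Let be := 2 * v.1 * v.2 / m ^+ 2.

Let nu_re_inv : nu_re inv = (al *: nu_re v - be *: nu_im v) *m half_turn.
Proof.
rewrite invE; apply/rowP => j; rewrite mul_half_turnE; move: j.
by apply: forall_ord3; rewrite !mxE /= /al /be; move: m0; rewrite /m => m0';
  field.
Qed.

Let nu_im_inv : nu_im inv = (be *: nu_re v + al *: nu_im v) *m half_turn.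
Proof.
rewrite invE; apply/rowP => j; rewrite mul_half_turnE; move: j.
by apply: forall_ord3; rewrite !mxE /= /al /be; move: m0; rewrite /m => m0';
  field.
Qed.

(** With $z = - v^{-2}$ the null vector at $1/v$ is $z \nu(v)$, up to the half
    turn, and the new coordinate is $c z^2$.  Hence $\bar c \nu^T \nu$ gets the
    factor $|z|^4$, which the change of $(1 + |u|^2)^{-4}$ compensates. *)
Lemma fib_inv c : fib inv (ofC (toC c / toC v ^+ 4)) =
  half_turn^T *m fib v c *m half_turn.
Proof.
have cE : ofC (toC c / toC v ^+ 4) =
   (c.1 * (al ^+ 2 - be ^+ 2) - c.2 * (2 * al * be),
    c.1 * (2 * al * be) + c.2 * (al ^+ 2 - be ^+ 2)).
  have zE : (toC v ^+ 4)^-1 = (al +i* be) ^+ 2.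
    have E : (al +i* be) * toC v ^+ 2 = -1.
      rewrite /toC expr2; simpc; apply/eqP; rewrite eq_complex /= /al /be.
      move: m0; rewrite /m => m0'.
      by apply/andP; split; apply/eqP; field.
    have v0' : toC v != 0 by rewrite toC_eq0.
    apply: (mulIf (expf_neq0 4 v0')); rewrite mulVf ?expf_neq0//.
    by rewrite -[4%N]/(2 * 2)%N exprM -exprMn E sqrrN expr1n.
  rewrite zE /toC /ofC expr2; simpc; congr (_, _) => /=; ring.
have ab : al ^+ 2 + be ^+ 2 = m ^- 2.
  by rewrite /al /be; move: m0; rewrite /m => m0'; field.
have NE : normsq inv = normsq v / m.
  by rewrite /normsq invE /=; move: m0; rewrite /m => m0'; field.
have outerE (x y : 'rV[R]_3) :
    (x *m half_turn)^T *m (y *m half_turn) =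
    half_turn^T *m (x^T *m y) *m half_turn.
  by rewrite trmx_mul !mulmxA.
rewrite cE /fib nu_re_inv nu_im_inv !outerE.
set f := fun M => half_turn^T *m M *m half_turn.
have fD M N : f M + f N = f (M + N) by rewrite /f mulmxDr mulmxDl.
have fB M N : f M - f N = f (M - N) by rewrite /f mulmxBr mulmxBl.
have fZ k M : k *: f M = f (k *: M) by rewrite /f -scalemxAr -scalemxAl.
rewrite -![half_turn^T *m _ *m half_turn]/(f _) fB fD !fZ fD fZ; congr f.
rewrite NE; move: (normsq v) (nu_re v) (nu_im v) => N a b.
apply/matrixP => i j; rewrite !mxE !big_ord1 !mxE.
have NN : (N / m) ^- 4 = N ^- 4 * m ^+ 4 by rewrite exprMn invfM exprVn invrK.
transitivity (N ^- 4 * m ^+ 4 * (al ^+ 2 + be ^+ 2) ^+ 2 *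
  (c.1 * (a 0 i * a 0 j - b 0 i * b 0 j) +
   c.2 * (a 0 i * b 0 j + b 0 i * a 0 j))).
  rewrite NN /=. ring.
have mm : m ^+ 4 * (m ^- 2) ^+ 2 = 1 by rewrite exprVn -exprM mulfV ?expf_neq0.
by rewrite ab -(mulrA (N ^- 4)) mm mulr1.
Qed.

End Inversion.

Lemma dnbhs_plane_proper : ProperFilter (0 : plane R)^'.
Proof.
apply: Build_ProperFilter_ex => A /nbhs_ballP [_/posnumP[e] eA].
exists (e%:num / 2, 0); apply: eA; last by rewrite -pair_eqE /= negb_and gt_eqF.
split=> /=; last exact: ballxx.
rewrite -ball_normE /= sub0r normrN gtr0_norm//.
by rewrite ltr_pdivrMr// mulr_natr mulr2n ltrDl.
Qed.

(** Away from $v = 0$ this is the transition formula [fib_inv]; at $v = 0$ the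
    chart is defined as a limit, which is the value of the continuous right-hand
    side. *)
Lemma param_vE : @param_v R = rotated_param half_turn.
Proof.
have fE v c : v != 0 -> param_u (ofC (toC v)^-1, ofC (toC c / toC v ^+ 4)) =
    rotated_param half_turn (v, c).
  move=> v0; rewrite param_uE /rotated_param /= stereo_inv// fib_inv//.
  by rewrite trmx1 mul1mx !mulmx1.
apply/funext => -[v c]; rewrite /param_v /=.
case: ifPn => [/eqP ->|v0]; last exact: fE.
have cvg_f : (param_u (ofC (toC w)^-1, ofC (toC c / toC w ^+ 4)) : ambient R)
    @[w --> (0 : plane R)^'] --> rotated_param half_turn (0, c).
  have cts : {for (0 : plane R),
      continuous (fun w => rotated_param half_turn (w, c))}.
    apply: (@cvg_comp _ _ _ (fun w : plane R => (w, c))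
      (rotated_param half_turn) _ (nbhs (0 : plane R, c))).
      exact: (@cvg_pair _ _ _ (nbhs (0 : plane R)) (nbhs (0 : plane R)) (nbhs c)
        _ _ _ id (cst c) cvg_id (cvg_cst c)).
    exact: (differentiable_continuous (differentiable_rotated_param _ _)).
  move/continuous_withinNx : cts.
  apply: cvg_trans; apply: near_eq_cvg; near=> w.
  rewrite fE//; near: w; exact: nbhs_dnbhs_neq.
case: xgetP => [p _ /= cvg_p|/(_ (rotated_param half_turn (0, c))) []//].
have PF := dnbhs_plane_proper.
apply: cvg_unique cvg_p cvg_f; exact: norm_hausdorff.
Unshelve. all: by end_near. Qed.

End Charts.

(** * Complex-valued functions of real variables *)

Section ComplexDerivative.
Variables (R : realType) (V : normedModType R) (x v : V).
Implicit Types (f h : V -> R[i]) (D E : R[i]).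

Definition is_cderive f D :=
  is_derive x v (fun y => complex.Re (f y)) (complex.Re D) /\
  is_derive x v (fun y => complex.Im (f y)) (complex.Im D).

Lemma is_cderive_cst (c : R[i]) : is_cderive (fun=> c) 0.
Proof. by split; exact: is_derive_cst. Qed.

Lemma is_cderiveD f h D E : is_cderive f D -> is_cderive h E ->
  is_cderive (fun y => f y + h y) (D + E).
Proof.
have ReD (a b : R[i]) : complex.Re (a + b) = complex.Re a + complex.Re b.
  by case: a; case: b.
have ImD (a b : R[i]) : complex.Im (a + b) = complex.Im a + complex.Im b.
  by case: a; case: b.
move=> [f1 f2] [h1 h2]; split.
  rewrite ReD (_ : (fun y => _) =
      (fun y => complex.Re (f y)) + (fun y => complex.Re (h y))).
    exact: is_deriveD.
  by apply/funext => y; rewrite ReD.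
rewrite ImD (_ : (fun y => _) =
      (fun y => complex.Im (f y)) + (fun y => complex.Im (h y))).
  exact: is_deriveD.
by apply/funext => y; rewrite ImD.
Qed.

Lemma is_cderiveM f h D E : is_cderive f D -> is_cderive h E ->
  is_cderive (fun y => f y * h y) (D * h x + f x * E).
Proof.
have ReM (a b : R[i]) : complex.Re (a * b) =
  complex.Re a * complex.Re b - complex.Im a * complex.Im b by case: a; case: b.
have ImM (a b : R[i]) : complex.Im (a * b) =
  complex.Re a * complex.Im b + complex.Im a * complex.Re b by case: a; case: b.
move=> [f1 f2] [h1 h2]; split.
  rewrite (_ : (fun y => _) = (fun y => complex.Re (f y) * complex.Re (h y)) -
    (fun y => complex.Im (f y) * complex.Im (h y))); last first.
    by apply/funext => y; rewrite ReM.
  apply: (is_derive_eq (is_deriveB (is_derive_mul f1 h1) (is_derive_mul f2 h2))).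
  case: (f x) (h x) D E {f1 f2 h1 h2} => [? ?] [? ?] [? ?] [? ?].
  by simpc => /=; ring.
rewrite (_ : (fun y => _) = (fun y => complex.Re (f y) * complex.Im (h y)) +
  (fun y => complex.Im (f y) * complex.Re (h y))); last first.
  by apply/funext => y; rewrite ImM.
apply: (is_derive_eq (is_deriveD (is_derive_mul f1 h2) (is_derive_mul f2 h1))).
case: (f x) (h x) D E {f1 f2 h1 h2} => [? ?] [? ?] [? ?] [? ?].
by simpc => /=; ring.
Qed.

Lemma is_cderiveV f D : f x != 0 -> is_cderive f D ->
  is_cderive (fun y => (f y)^-1) (- (f x) ^- 2 * D).
Proof.
move=> f0 [f1 f2].
have n0 : complex.Re (f x) ^+ 2 + complex.Im (f x) ^+ 2 != 0.
  move: f0; case: (f x) => a b.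
  by rewrite paddr_eq0 ?sqr_ge0// !sqrf_eq0 eq_complex.
have dn := is_deriveD (is_derive_mul f1 f1) (is_derive_mul f2 f2).
have dN := is_derive_inv
  (f := fun y => complex.Re (f y) ^+ 2 + complex.Im (f y) ^+ 2) n0 dn.
have f3 : is_derive x v (fun y => - complex.Im (f y)) (- complex.Im D).
  exact: is_deriveN f2.
split.
  rewrite (_ : (fun y => _) = (fun y => complex.Re (f y) *
    (complex.Re (f y) ^+ 2 + complex.Im (f y) ^+ 2)^-1)); last first.
    by apply/funext => y; case: (f y).
  apply: (is_derive_eq (is_derive_mul f1 dN)); move: n0.
  case: (f x) D {f0 f1 f2 f3 dn dN} => [a b] [c d] /= n0.
  rewrite expr2; simpc => /=; field; rewrite -expr2 n0 andbT.
  by rewrite [X in X != 0](_ : _ = (a ^+ 2 + b ^+ 2) ^+ 2) ?expf_neq0//; ring.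
rewrite (_ : (fun y => _) = (fun y => - complex.Im (f y) *
  (complex.Re (f y) ^+ 2 + complex.Im (f y) ^+ 2)^-1)); last first.
  by apply/funext => y; case: (f y) => a b /=; rewrite mulNr.
apply: (is_derive_eq (is_derive_mul f3 dN)); move: n0.
case: (f x) D {f0 f1 f2 f3 dn dN} => [a b] [c d] /= n0.
rewrite expr2; simpc => /=; field; rewrite -expr2 n0 andbT.
by rewrite [X in X != 0](_ : _ = (a ^+ 2 + b ^+ 2) ^+ 2) ?expf_neq0//; ring.
Qed.

End ComplexDerivative.

(** * The exterior derivative of the one-form *)

Lemma is_derive_row (R : realType) (V : normedModType R) n (f : 'I_n -> V -> R)
    x v (D : 'I_n -> R) :
  (forall j, is_derive x v (f j) (D j)) ->
  is_derive x v (fun y => \row_j f j y) (\row_j D j).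
Proof.
move=> df; apply: is_derive_matrix => i j; rewrite !mxE.
by rewrite (_ : (fun y => _) = f j)//; apply/funext => y; rewrite mxE.
Qed.

Lemma quotient_rule_identity (F : fieldType) (c q dq n dn : F) : q != 0 ->
  (0 / q + c * (- q ^- 2 * dq)) * n + c / q * dn =
  c * (dn / q - dq / q ^+ 2 * n).
Proof. by move=> q0; field. Qed.

(** Antisymmetrization cancels the terms with [dn]. *)
Lemma alternation_identity (F : fieldType) (q n dn du dq du' dq' : F) :
  q != 0 ->
  - 2 * du' * (dn * du / q - dq / q ^+ 2 * n) -
  - 2 * du * (dn * du' / q - dq' / q ^+ 2 * n) =
  2 / q ^+ 2 * (dq * du' - dq' * du) * n.
Proof. by move=> q0; field. Qed.

Section ExteriorDerivative.
Variables (R : realType) (g : 'M[R]_3).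
Hypothesis gg : g *m g^T = 1%:M.
Implicit Types (x xi eta : plane R * plane R).

Lemma is_cderive_fst x xi : is_cderive x xi (fun y => toC y.1) (toC xi.1).
Proof. by split; apply: is_derive_affine. Qed.

Lemma is_cderive_snd x xi : is_cderive x xi (fun y => toC y.2) (toC xi.2).
Proof. by split; apply: is_derive_affine. Qed.

Lemma eq_is_cderive (V : normedModType R) (x v : V) f h D E :
  is_cderive x v f D -> (forall y, f y = h y) -> D = E -> is_cderive x v h E.
Proof. by move=> H /funext <- <-. Qed.

Definition dnull_vec (u : R[i]) (j : 'I_3) : R[i] :=
  [:: - 2 * u; 'i%C * (2 * u); 2]`_j.

Lemma is_cderive_null_vec j x xi :
  is_cderive x xi (fun y => null_vec (toC y.1) j)
    (dnull_vec (toC x.1) j * toC xi.1).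
Proof.
have d1 := is_cderive_fst x xi.
have dsq := is_cderiveM d1 d1.
have dc c := is_cderive_cst x xi c.
move: j; apply: forall_ord3.
- apply: (eq_is_cderive
    (is_cderiveD (dc 1) (is_cderiveM (dc (-1)) dsq))) => [y|];
    rewrite /dnull_vec /null_vec /=; ring.
- apply: (eq_is_cderive
    (is_cderiveM (dc 'i%C) (is_cderiveD (dc 1) dsq))) => [y|];
    rewrite /dnull_vec /null_vec /=; ring.
- apply: (eq_is_cderive (is_cderiveM (dc 2) d1)) => [y|];
    rewrite /dnull_vec /null_vec /=; ring.
Qed.

(** In coordinates $\omega = Re(-2 q^{-1} \nu(u) du)$. *)
Lemma pullback_omegaE y eta : y.2 != 0 ->
  pullback_omega (rotated_param g) y eta =
  (\row_j complex.Re (- 2 * toC eta.1 / toC y.2 * null_vec (toC y.1) j)) *m g.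
Proof.
move=> y2; rewrite /pullback_omega /omega derive_param_fst.
by rewrite [y in rotated_param g y]surjective_pairing fibre_inv_rotated.
Qed.

Lemma derive_pullback_omega x xi eta : x.2 != 0 ->
  'D_xi (pullback_omega (rotated_param g) ^~ eta) x =
  (\row_j complex.Re (- 2 * toC eta.1 *
     (dnull_vec (toC x.1) j * toC xi.1 / toC x.2
      - toC xi.2 / toC x.2 ^+ 2 * null_vec (toC x.1) j))) *m g.
Proof.
move=> x2; apply: derive_val.
have E : {near x, forall y,
    (\row_j complex.Re (- 2 * toC eta.1 / toC y.2 * null_vec (toC y.1) j)) *m g
    = pullback_omega (rotated_param g) y eta}.
  near=> y; rewrite pullback_omegaE//; near: y.
  have : {for x, continuous (fun y : plane R * plane R => y.2)}.
    exact: cvg_snd.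
  by move=> /cvgr_neq0; apply.
apply: (near_eq_is_derive E).
apply: is_derive_mulmxr; apply: is_derive_row => j.
have x2' : toC x.2 != 0 by rewrite toC_eq0.
have dinv := @is_cderiveV _ _ x xi (fun y => toC y.2) _ x2'
  (is_cderive_snd x xi).
have dq := is_cderiveM (is_cderive_cst x xi (- 2 * toC eta.1)) dinv.
have [H _] := is_cderiveM dq (is_cderive_null_vec j x xi).
apply: (is_derive_eq H); congr complex.Re; exact: quotient_rule_identity.
Unshelve. all: by end_near. Qed.

Lemma row_nu_eq0 u (z : R[i]) :
  (\row_j complex.Re (z * null_vec (toC u) j)) *m g = 0 -> z = 0.
Proof.
rewrite -[RHS](mul0mx _ g) => /(mulmx_orthogonal_inj gg).
rewrite row_nu -(nu_comb0 u) => /nu_comb_inj h.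
by apply: conj_pair_inj; rewrite h /= oppr0.
Qed.

(** The terms with the derivative of $\nu$ are symmetric in $\xi_1$ and $\eta_1$
    and cancel; the rest is the real part of a complex multiple of $\nu$, which
    vanishes only if the factor does. *)
Lemma ext_deriv_pullback_eq0 x xi eta : x.2 != 0 ->
  ext_deriv (pullback_omega (rotated_param g)) x xi eta = 0 ->
  toC xi.2 * toC eta.1 = toC eta.2 * toC xi.1.
Proof.
move=> x2.
have E := f_equal2 (fun a b : 'rV[R]_3 => a - b)
  (derive_pullback_omega xi eta x2) (derive_pullback_omega eta xi x2).
rewrite [ext_deriv _ _ _ _]E -mulmxBl.
have x2' : toC x.2 != 0 by rewrite toC_eq0.
set d := toC xi.2 * toC eta.1 - toC eta.2 * toC xi.1.
have ReB (a b : R[i]) : complex.Re a - complex.Re b = complex.Re (a - b).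
  by case: a; case: b.
rewrite (_ : _ - _ =
    \row_j complex.Re (2 / toC x.2 ^+ 2 * d * null_vec (toC x.1) j)).
  move=> /row_nu_eq0/eqP; rewrite !mulf_eq0 invr_eq0 expf_eq0 /= (negbTE x2').
  by rewrite pnatr_eq0 /= subr_eq0 => /eqP.
apply/rowP => j; rewrite !mxE ReB; congr complex.Re.
exact: alternation_identity.
Qed.

End ExteriorDerivative.

Lemma exists_rotated_param (R : realType) (q : ambient R) :
  Qset q -> q.2 <> 0 ->
  exists h : 'M[R]_3, [/\ h *m h^T = 1%:M, param q = rotated_param h,
    rotated_param h (chart_coord q) = q & (chart_coord q).2 != 0].
Proof.
move=> Qq q0.
suff [h [hh pE [x xE]]] : exists h : 'M[R]_3, [/\ h *m h^T = 1%:M,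
    param q = rotated_param h & exists x, rotated_param h x = q].
  exists h; rewrite /chart_coord pE; case: xgetP => [y _ /= yE|/(_ x)//].
  split=> //; apply/eqP => y2; apply: q0.
  by rewrite -yE /= y2 fib0 mulmx0 mul0mx.
rewrite /param; case: ifPn => [/eqP q1|q1].
  exists (half_turn R); rewrite param_vE.
  split=> //; first exact: half_turn_orthogonal.
  have [|c ->] := rotated_param_surj (u := 0) (@half_turn_orthogonal R) Qq;
    last by exists (0, c).
  rewrite q1; apply/rowP => j; rewrite mul_half_turnE; move: j.
  by apply: forall_ord3; rewrite !mxE /= ?expr0n /=; field.
exists 1%:M; rewrite param_uE; split=> //; first exact: one_orthogonal.
have [sq _ _ _] := Qq.
have n1 : 1 + q.1 0 2 != 0.
  apply: contra q1 => /eqP z; have {}z : q.1 0 2 = -1.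
    by apply/eqP; rewrite -addr_eq0 addrC z.
  move: sq; rewrite /sphere /= dotE z mulrNN mulr1 => /eqP.
  rewrite -subr_eq0 addrK -!expr2 paddr_eq0 ?sqr_ge0// !sqrf_eq0.
  move=> /andP [/eqP s1 /eqP s2].
  by apply/eqP/rowP; apply: forall_ord3; rewrite ?s1 ?s2 ?z !mxE ?oppr0.
(* The stereographic projection of $s$; it has $1 + |u|^2 = 2/(1 + s_3)$. *)
pose u : plane R := (- q.1 0 0 / (1 + q.1 0 2), - q.1 0 1 / (1 + q.1 0 2)).
have [|c ->] := rotated_param_surj (u := u) (@one_orthogonal R) Qq;
  last by exists (u, c).
rewrite mulmx1; move: sq; rewrite /sphere /= dotE => sq.
have nE : 1 + (u.1 ^+ 2 + u.2 ^+ 2) = 2 / (1 + q.1 0 2).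
  transitivity ((q.1 0 0 * q.1 0 0 + q.1 0 1 * q.1 0 1 + q.1 0 2 * q.1 0 2 +
    2 * q.1 0 2 + 1) / (1 + q.1 0 2) ^+ 2); first by rewrite /u /=; field.
  by rewrite sq; field.
have n2 : u.1 ^+ 2 + u.2 ^+ 2 = 2 / (1 + q.1 0 2) - 1.
  by rewrite -nE [X in _ = X - 1]addrC addrK.
apply/rowP; apply: forall_ord3; rewrite !mxE nE /=.
- by rewrite /u /=; field.
- by rewrite /u /=; field.
- by rewrite n2; field.
Qed.

(** * Maps preserving all complex directions *)

(** The vector $v$ has the coordinates [z v] and [w v], and
    $J v$ is a multiple of $v$ by a number that may depend on $v$.  Adding to $v$
    either vector of the standard basis forces this number to be that of the
    basis vectors. *)
Lemma complex_direction_scalar (V : zmodType) (K : fieldType) (J : V -> V)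
    (z w : V -> K) :
  {morph J : a b / a + b} -> {morph z : a b / a + b} ->
  {morph w : a b / a + b} ->
  (forall a b, exists v, z v = a /\ w v = b) ->
  (forall v, w v * z (J v) = w (J v) * z v) ->
  exists l, forall v, z (J v) = l * z v /\ w (J v) = l * w v.
Proof.
move=> JD zD wD surj det.
have [e [ze we]] := surj 1 0; have [f [zf wf]] := surj 0 1.
have wJe : w (J e) = 0 by have := det e; rewrite ze we mul0r mulr1.
have zJf : z (J f) = 0 by have := det f; rewrite zf wf mul1r mulr0.
have lm : w (J f) = z (J e).
  have := det (e + f); rewrite JD !zD !wD ze zf we wf wJe zJf.
  by rewrite !addr0 !add0r mulr1 mul1r.
exists (z (J e)) => v; have dv := det v; split.
  have := det (v + f); rewrite JD !zD !wD zf wf zJf lm.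
  by rewrite !addr0 mulrDl mulrDl dv mul1r => /addrI.
have := det (v + e); rewrite JD !zD !wD ze we wJe.
by rewrite !addr0 mulrDr mulrDr dv mulr1 => /addrI; rewrite mulrC.
Qed.

(** * Uniqueness of the complex structure *)

Theorem mainTheorem4 (R : realType) (q : 'rV[R]_3 * 'M[R]_3)
    (hq : Qset q) (hq0 : q.2 <> 0) (J : 'End(subvs_of (TQ q)))
    (hJ : forall v : subvs_of (TQ q), J (J v) = - v)
    (hiso : [set P : {vspace subvs_of (TQ q)} | \dim P = 2%N /\ isotropic P] =
            [set P : {vspace subvs_of (TQ q)} | complex_line J P]) :
  (forall v : subvs_of (TQ q), vsval (J v) = mulI q (vsval v)) \/
  (forall v : subvs_of (TQ q), vsval (J v) = - mulI q (vsval v)).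
Proof.
have [g [gg pE xq x2]] := exists_rotated_param hq hq0.
set x := chart_coord q in xq x2.
pose D xi := 'D_xi (rotated_param g) x.
have tcoordE xi : tcoord q (D xi) = xi.
  rewrite /tcoord pE; case: xgetP => [eta _ /= etaE|/(_ xi) []//].
  exact: (derive_param_inj gg etaE).
have DT xi : D xi \in TQ q by rewrite -[X in TQ X]xq; exact: derive_param_TQ.
pose T (v : subvs_of (TQ q)) := tcoord q (vsval v).
have TK v : D (T v) = vsval v.
  have : vsval v \in TQ (rotated_param g x) by rewrite xq subvsP.
  by move=> /(derive_param_surj gg) [xi xiE]; rewrite /T -xiE tcoordE.
have TD : {morph T : v w / v + w}.
  move=> v w; apply: (derive_param_inj gg (x := x)).
  by rewrite derive_paramD -!/(D _) !TK.
have T0 : T 0 = 0 by apply: (addrI (T 0)); rewrite -TD !addr0.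
have T_surj xi : exists v, T v = xi.
  by exists (vsproj (TQ q) (D xi)); rewrite /T vsprojK.
have det v : toC (T v).2 * toC (T (J v)).1 = toC (T (J v)).2 * toC (T v).1.
  have [->|v0] := eqVneq v 0.
    by rewrite linear0 T0 mulrC.
  have : [set P | complex_line J P] (<[v]> + <[J v]>)%VS by exists v.
  rewrite -hiso => -[_ iso].
  apply: (ext_deriv_pullback_eq0 gg x2); rewrite -pE.
  apply: iso; first by rewrite (subvP (addvSl _ _)) ?memv_line.
  by rewrite (subvP (addvSr _ _)) ?memv_line.
have [||||l lE] := @complex_direction_scalar _ _ J
  (fun v => toC (T v).1) (fun v => toC (T v).2) _ _ _ _ det.
- exact: linearD.
- by move=> v w; rewrite TD.
- by move=> v w; rewrite TD.
- move=> a b; have [v vE] := T_surj (ofC a, ofC b).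
  by exists v; rewrite vE !ofCK.
have TN v : T (- v) = - T v.
  by apply/eqP; rewrite -addr_eq0 -TD addNr T0.
(* Evaluate J twice at the vector with coordinates (1, 0). *)
have l2 : l ^+ 2 = -1.
  have [v vE] := T_surj (ofC 1, ofC 0).
  have [e _] := lE v; have [e' _] := lE (J v).
  move: e'; rewrite hJ TN e (_ : toC (- T v).1 = - toC (T v).1)//.
  by rewrite vE ofCK !mulr1 expr2 => <-.
have mulIE v : mulI q (vsval v) = D (imul (T v)) by rewrite /mulI pE.
have TJ v : T (J v) = (ofC (l * toC (T v).1), ofC (l * toC (T v).2)).
  by have [<- <-] := lE v; rewrite !toCK -surjective_pairing.
have : l ^+ 2 == 'i%C ^+ 2 by rewrite l2 sqr_i.
rewrite eqf_sqr => /orP [] /eqP lE'; [left|right] => v;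
  rewrite mulIE -[LHS]TK TJ lE' //.
rewrite -derive_paramN; congr ('D_ _ _ _).
by rewrite /imul !mulNr.
Qed.
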